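(* Let $\mathcal{P}$ be transversal and let $\mathcal{Q}$ be a birational parametrization of $X$ such that $\mathscr{B}(\mathcal{Q})=\emptyset$. Let $$D:=\sum_{A\in\mathscr{B}(\mathcal{P})}\sqrt{\frac{\mathrm{mult}(A,\mathscr{B}(\mathcal{P}))}{\deg(X)}}\;A,$$ let $d:=\deg(\mathcal{P})/\sqrt{\deg(X)}$, and let $\mathscr{L}_d(D)$ be the linear system of degree $d$ defined by the divisor $D$. If $(\mathcal{Q},\mathcal{S})$ solves the birational reparametrization problem for $\mathcal{P}$, where $\mathcal{S}=(s_1:s_2:s_3)$ and $\deg(s_i)=d$, then $s_1,s_2,s_3\in\mathscr{L}_d(D)$.
   Context: $\mathbb{K}$ is an algebraically closed field of characteristic zero. $X\subset\mathbb{P}^3(\mathbb{K})$ is a rational projective surface of degree $\deg(X)$, and $\mathcal{P}=(p_1:p_2:p_3:p_4):\mathbb{P}^2(\mathbb{K})\dashrightarrow X$ is a fixed non-birational projective rational parametrization of $X$: the $p_i\in\mathbb{K}[t_1,t_2,t_3]$ are homogeneous, the non-zero ones of the same degree $\deg(\mathcal{P})$, $\gcd(p_1,\ldots,p_4)=1$, $p_4\neq0$, and $\mathcal{P}$ is dominant onto $X$ (hence generically finite) but not birational. $(\mathcal{Q},\mathcal{S})$ solves the birational reparametrization problem for $\mathcal{P}$ if $\mathcal{Q}:\mathbb{P}^2(\mathbb{K})\dashrightarrow X$ is a birational parametrization of $X$ (a birational map), $\mathcal{S}:\mathbb{P}^2(\mathbb{K})\dashrightarrow\mathbb{P}^2(\mathbb{K})$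 is a rational map, and $\mathcal{P}=\mathcal{Q}\circ\mathcal{S}$. All rational maps are written with coprime homogeneous components. Base locus: for $\mathcal{M}=(m_1:\cdots:m_{k+1}):\mathbb{P}^2(\mathbb{K})\dashrightarrow\mathbb{P}^k(\mathbb{K})$, with non-zero $m_i$ homogeneous of the same degree and $\gcd(m_1,\dots,m_{k+1})=1$, the base locus $\mathscr{B}(\mathcal{M})$ is the (empty or finite) set of common zeros in $\mathbb{P}^2(\mathbb{K})$ of all the $m_i$. Put $W_1=\sum_i x_i m_i(\overline t)$ and $W_2=\sum_i y_i m_i(\overline t)$, with $x_i,y_i$ new variables, and let $\mathscr{C}(W_1),\mathscr{C}(W_2)$ be the corresponding plane curves in $\mathbb{P}^2(\mathbb{F})$, $\mathbb{F}$ the algebraic closure of $\mathbb{K}(\overline x,\overline y)$. For $A\in\mathscr{B}(\mathcal{M})$, $\mathrm{mult}(A,\mathscr{B}(\mathcal{M}))$ is the intersection multiplicity of $\mathscr{C}(W_1)$ and $\mathscr{C}(W_2)$ at $A$, and $\mathrm{mult}(A,\mathscr{C}(f))$ is the multiplicity of the curve $\mathscr{C}(f)$ defined by $f$ at $A$. $\mathcal{M}$ is transversal if $\mathrm{mult}(A,\mathscr{B}(\mathcal{M}))=\mathrm{mult}(A,\mathscr{C}(W_1))^2$ for every $A\in\mathscr{B}(\mathcal{M})$. Linear system: for a formal sum $D=\sum_A r_A A$ of points of $\mathbb{P}^2(\mathbb{K})$ with non-negative coefficients, $\mathscr{L}_d(D)$ is the linear system of plane curves (forms $f$ in $t_1,t_2,t_3$)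 of degree $d$ such that $\mathrm{mult}(A,\mathscr{C}(f))\ge r_A$ for every $A$ occurring in $D$. *)

(* Defs.v *)
From mathcomp Require Import all_boot all_order all_algebra all_field.
From mathcomp Require Import mpoly.
From mathcomp Require classical_sets.

Set Implicit Arguments.
Unset Strict Implicit.
Unset Printing Implicit Defensive.

Import Order.TTheory GRing.Theory Num.Theory.
Local Open Scope ring_scope.

(* A point of P^(n-1)(K) is given by a non-zero vector of homogeneous
   coordinates; every notion below is invariant under rescaling it. *)
Definition is_point (K : fieldType) n (a : 'I_n -> K) : bool :=
  [exists i, a i != 0].

Definition coprime_family (K : fieldType) n m (p : m.-tuple {mpoly K[n]}) : Prop :=
  forall g : {mpoly K[n]},
    (forall i, exists h, tnth p i = g * h) -> g \is a GRing.unit.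

(* Rational maps P^(n-1) --> P^(m-1) in lowest terms. The zero polynomial is
   homogeneous of every degree, and coprimality forces some component to be
   non-zero, so rdeg is the common degree of the non-zero components. *)
Record ratmap (K : fieldType) (n m : nat) := RatMap {
  comps :> m.-tuple {mpoly K[n]};
  rdeg : nat;
  comps_homog : forall i, tnth comps i \is rdeg.-homog;
  comps_coprime : coprime_family comps }.

Definition evmap (K : fieldType) n m (M : ratmap K n m) (t : 'I_n -> K)
  : 'I_m -> K := fun i => (tnth M i).@[t].

Definition base_locus (K : fieldType) n m (M : ratmap K n m) (a : 'I_n -> K) : bool :=
  is_point a && [forall i, (tnth M i).@[a] == 0].

(* Irreducible surfaces in P^3: zero loci of irreducible forms. The degree of
   the surface is the degree of its irreducible form. *)
Record surface (K : fieldType) := Surface {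
  sform : {mpoly K[4]};
  sdeg : nat;
  sform_homog : sform \is sdeg.-homog;
  sform_neq0 : sform != 0;
  sform_nonunit : sform \isn't a GRing.unit;
  sform_irr : forall g h, sform = g * h ->
    g \is a GRing.unit \/ h \is a GRing.unit }.

Definition on_surface (K : fieldType) (X : surface K) (x : 'I_4 -> K) : Prop :=
  is_point x /\ (sform X).@[x] = 0.

Definition vanishes_on (K : fieldType) (X : surface K) (G : {mpoly K[4]}) : Prop :=
  forall x, on_surface X x -> G.@[x] = 0.

(* The image of P lies in X and is Zariski dense in X. *)
Definition parametrizes (K : fieldType) (P : ratmap K 3 4) (X : surface K) : Prop :=
  (forall t, is_point t -> ~~ base_locus P t -> on_surface X (evmap P t)) /\
  (forall e (G : {mpoly K[4]}), G \is e.-homog ->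
     (forall t, is_point t -> ~~ base_locus P t -> G.@[evmap P t] = 0) ->
     vanishes_on X G).

(* The inverse X --> P^2 is given by three forms r of the same degree in the
   ambient coordinates, not all vanishing on X; both composites with P are
   defined and are the identity as rational maps. *)
Definition birational_onto (K : fieldType) (P : ratmap K 3 4) (X : surface K) : Prop :=
  exists (e : nat) (r : 3.-tuple {mpoly K[4]}),
    [/\ forall i, tnth r i \is e.-homog,
        exists i, tnth r i \mPo P != 0,
        forall i j, (tnth r i \mPo P) * 'X_j = (tnth r j \mPo P) * 'X_i,
        exists i, ~ vanishes_on X (tnth P i \mPo r)
      & forall i j, vanishes_on X
          ((tnth P i \mPo r) * 'X_j - (tnth P j \mPo r) * 'X_i)].

Definition birational_parametrization (K : fieldType) (Q : ratmap K 3 4)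
    (X : surface K) : Prop :=
  parametrizes Q X /\ birational_onto Q X.

(* P = Q o S as rational maps: the image of S is not contained in the base
   locus of Q, and the two sides agree up to a common factor. *)
Definition eq_comp (K : fieldType) n l m
    (P : ratmap K n m) (Q : ratmap K l m) (S : ratmap K n l) : Prop :=
  (exists i, tnth Q i \mPo S != 0) /\
  (forall i j, tnth P i * (tnth Q j \mPo S) = tnth P j * (tnth Q i \mPo S)).

Definition solves_birational_reparam (K : fieldType) (X : surface K)
    (P Q : ratmap K 3 4) (S : ratmap K 3 3) : Prop :=
  birational_parametrization Q X /\ eq_comp P Q S.

(* Equation of the plane curve f in the affine chart t_i = a_i, where i is the
   first index with a_i != 0, with the point a moved to the origin. *)
Definition local_eq (K : fieldType) (a : 'I_3 -> K) (f : {mpoly K[3]}) : {mpoly K[2]} :=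
  let i := odflt ord0 [pick i | a i != 0] in
  f \mPo [tuple (a k)%:MP + (if unlift i k is Some j then 'X_j else 0) | k < 3].

(* Multiplicity at a of the curve f: since monomials are ordered by degree
   first, this is the degree of the lowest form of the local equation.
   Meaningful only for f != 0. *)
Definition curve_mult (K : fieldType) (a : 'I_3 -> K) (f : {mpoly K[3]}) : nat :=
  mdeg (mlast (local_eq a f)).

Definition local_ring (F : fieldType) (z : {fraction {mpoly F[2]}}) : Prop :=
  exists u v : {mpoly F[2]}, v.@[fun=> 0] != 0 /\ z = tofrac u / tofrac v.

Definition local_ideal (F : fieldType) (f g : {mpoly F[2]})
    (z : {fraction {mpoly F[2]}}) : Prop :=
  exists a b, [/\ local_ring a, local_ring b & z = a * tofrac f + b * tofrac g].

(* The quotient of the local ring of the plane at the origin by (f, g) has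
   dimension n over F: it has a basis of n elements. *)
Definition local_dim (F : fieldType) (f g : {mpoly F[2]}) (n : nat) : Prop :=
  exists e : 'I_n -> {fraction {mpoly F[2]}},
    (forall i, local_ring (e i)) /\
    (forall z, local_ring z -> exists! c : {ffun 'I_n -> F},
       local_ideal f g (z - \sum_i tofrac (c i)%:MP * e i)).

(* Default value 0 when the dimension is infinite, i.e. when f and g share a
   component through a. *)
Definition intersection_mult (F : fieldType) (a : 'I_3 -> F) (f g : {mpoly F[3]}) : nat :=
  classical_sets.xget 0%N (local_dim (local_eq a f) (local_eq a g)).

(* K(x, y) with x = (x_1, .., x_m) and y = (y_1, .., y_m): the x_i are the
   first m indeterminates and the y_i the last m. *)
Notation genfrac K m := {fraction {mpoly K[m + m]}}.

Section Generic.
Context (K : fieldType) (m : nat) (F : fieldType).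
Variable iota : {rmorphism genfrac K m -> F}.

Definition gen_const (c : K) : F := iota (tofrac c%:MP).

Definition W1 (M : ratmap K 3 m) : {mpoly F[3]} :=
  \sum_(i < m) iota (tofrac 'X_(lshift m i)) *: map_mpoly gen_const (tnth M i).

Definition W2 (M : ratmap K 3 m) : {mpoly F[3]} :=
  \sum_(i < m) iota (tofrac 'X_(rshift m i)) *: map_mpoly gen_const (tnth M i).

Definition base_mult (M : ratmap K 3 m) (a : 'I_3 -> K) : nat :=
  intersection_mult (gen_const \o a) (W1 M) (W2 M).

Definition transversal_map (M : ratmap K 3 m) : Prop :=
  forall a, base_locus M a ->
    base_mult M a = (curve_mult (gen_const \o a) (W1 M) ^ 2)%N.

(* Coefficients of D; they are a priori real algebraic, not integers. *)
Definition base_divisor (M : ratmap K 3 m) (degX : nat) (a : 'I_3 -> K) : algC :=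
  if base_locus M a then sqrtC ((base_mult M a)%:R / degX%:R) else 0.

End Generic.

(* Forms of degree d whose multiplicity at each point a is at least D a; the
   zero form has infinite multiplicity everywhere. *)
Definition in_linear_system (K : fieldType) (d : nat) (D : ('I_3 -> K) -> algC)
    (f : {mpoly K[3]}) : Prop :=
  f \is d.-homog /\
  (f != 0 -> forall a, is_point a -> D a <= (curve_mult a f)%:R).

(* Main.v *)
From HB Require Import structures.
Require Import Defs.
From mathcomp Require Import all_boot all_order all_algebra all_field.
From mathcomp Require Import mpoly.
From Stdlib Require Import Classical.

Set Implicit Arguments.
Unset Strict Implicit.
Unset Printing Implicit Defensive.

Import Order.TTheory GRing.Theory Num.Theory.
Local Open Scope ring_scope.

(** Let [e] be the degree of the forms of [Q]. The theorem comes down to the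
    inequality [mult_a W1 <= e * mult_a s_i] at each base point [a] of [P].
    Indeed transversality makes the coefficient of [a] in the divisor equal to
    [mult_a W1 / sqrt (deg X)], and [sqrt (deg X) = e]. The latter needs no
    intersection theory: [P = c Q(S)] in lowest terms, so [deg P = e * deg S],
    while [deg S = d = deg P / sqrt (deg X)] by hypothesis; and if [d = 0],
    then [P] is constant and has no base point.

    Both facts rest on the absence of base points of [Q].

    - No cancellation occurs in [Q(S)]
      ([base_free_comp_lowest_terms]). A prime form [f] dividing all the
      [q_j(S)] does not divide some [s_k], by coprimality of [S]; then some
      point [t] satisfies [f(t) = 0] and [s_k(t) <> 0]
      ([hypersurface_zero_avoiding]), and [S(t)] would be a base point of [Q].
      So the [q_j(S)] are coprime, and coprime families that are proportional
      differ by a constant ([proportional_coprime]). These steps use unique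
      factorization in polynomial rings ([factorial_mpoly]).

    - Some [q_j(S)] has multiplicity at most [e * mult_a s_i] at [a]
      ([local_mult_base_free_comp]). Restrict everything to a line
      through [a] on which [s_i] keeps its multiplicity, and take out of the
      restrictions of the [s_k] the largest common power [T^v] of the parameter;
      what remains takes a non-zero value at [T = 0], and some [q_j] does not
      vanish there. So [q_j(S)] has order exactly [e v] on the line, and
      [v <= mult_a s_i].

    The multiplicity of [W1] is at most that of each component of [P], since
    the coefficients [x_i] of [W1] are independent over [K]
    ([curve_mult_W1_le]). *)

(** * Primes and factorial rings *)

Definition divides {R : comNzRingType} (a b : R) : Prop := exists c, b = a * c.

Definition prime_elt {R : idomainType} (p : R) : Prop :=
  [/\ p != 0, p \isn't a GRing.unit
    & forall a b, divides p (a * b) -> divides p a \/ divides p b].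

(** Units count as empty products, so that the ring is factorial exactly when
    every non-zero element is a product of primes. *)
Inductive prime_product {R : idomainType} : R -> Prop :=
| PrimeProductUnit u : u \is a GRing.unit -> prime_product u
| PrimeProductMul p a :
    prime_elt p -> prime_product a -> prime_product (p * a).

Definition factorial_ring (R : idomainType) : Prop :=
  forall a : R, a != 0 -> prime_product a.

(** Over a factorial ring, this says that the content of [f] is a unit. *)
Definition primitive {R : idomainType} (f : {poly R}) : Prop :=
  forall c, divides c%:P f -> c \is a GRing.unit.

Lemma divides_mulr {R : comNzRingType} (p a b : R) :
  divides p a -> divides p (a * b).
Proof. by case=> c ->; exists (c * b); rewrite mulrA. Qed.

Lemma divides_mull {R : comNzRingType} (p a b : R) :
  divides p b -> divides p (a * b).
Proof. by rewrite mulrC; apply: divides_mulr. Qed.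

Lemma dividesDr {R : comNzRingType} (p a b : R) :
  divides p a -> divides p (a + b) -> divides p b.
Proof.
by case=> c -> [e E]; exists (e - c); rewrite mulrBr -E addrAC subrr add0r.
Qed.

Lemma unit_of_dvd_unit {R : idomainType} (u a : R) :
  u \is a GRing.unit -> divides a u -> a \is a GRing.unit.
Proof. by move=> Uu [c E]; move: Uu; rewrite E unitrM => /andP[]. Qed.

Lemma prime_product_neq0 {R : idomainType} (a : R) : prime_product a -> a != 0.
Proof.
elim=> [u Uu|p b [p0 _ _] _ b0]; last by rewrite mulf_neq0.
by apply: contraTneq Uu => ->; rewrite unitr0.
Qed.

Lemma prime_productM {R : idomainType} (a b : R) :
  prime_product a -> prime_product b -> prime_product (a * b).
Proof.
move=> ha hb; elim: ha => [u Uu|p c pp _ IH]; last first.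
  by rewrite -mulrA; constructor.
case: hb => [v Uv|p c pp hc]; first by constructor; rewrite unitrM Uu.
rewrite mulrCA; constructor => //; elim: {p pp} hc => [v Uv|q e qp _ IH].
  by constructor; rewrite unitrM Uu.
by rewrite mulrCA; constructor.
Qed.

Section Transfer.
Context {R T : idomainType} (f : {rmorphism R -> T}) (g : {rmorphism T -> R}).
Hypotheses (fK : cancel f g) (gK : cancel g f).

Lemma divides_iso a b : divides (f a) (f b) -> divides a b.
Proof.
by case=> c E; exists (g c); apply: (can_inj fK); rewrite rmorphM gK.
Qed.

Lemma prime_iso p : prime_elt p -> prime_elt (f p).
Proof.
case=> p0 pU pP; split.
- by rewrite -(rmorph0 f) (inj_eq (can_inj fK)).
- by apply: contra pU => U; rewrite -(fK p); apply: rmorph_unit.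
move=> a b; rewrite -(gK a) -(gK b) -rmorphM => /divides_iso/pP [] [c ->].
  by left; exists (f c); rewrite rmorphM.
by right; exists (f c); rewrite rmorphM.
Qed.

Lemma prime_product_iso a : prime_product a -> prime_product (f a).
Proof.
elim=> [u Uu|p b pp _ IH]; first by constructor; apply: rmorph_unit.
by rewrite rmorphM; constructor => //; apply: prime_iso.
Qed.
End Transfer.

(** * Factoriality of univariate polynomials *)

Section Gauss.
Context {R : idomainType}.
Implicit Types (f g h : {poly R}) (c p : R).

Lemma divides_polyC_MX c f : c != 0 -> divides c%:P (f * 'X) -> divides c%:P f.
Proof.
move=> c0 [h]; elim/poly_ind: h => [|h d _] E.
  by exists 0; apply: (mulIf (monic_neq0 (monicX R))); rewrite E mulr0 mul0r.
have d0 : d = 0.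
  have /polyP/(_ 0%N) := E; rewrite coefMX coefCM coefD coefMX coefC /= add0r.
  by move/esym/eqP; rewrite mulf_eq0 (negPf c0) => /eqP.
exists h; apply: (mulIf (monic_neq0 (monicX R))).
by rewrite E d0 addr0 mulrA.
Qed.

(** The quotients of the coefficients are only known to exist; the induction
    assembles them into a polynomial without choosing them. *)
Lemma divides_polyC_coef c f : (forall i, divides c f`_i) -> divides c%:P f.
Proof.
elim/poly_ind: f => [|f d IH] H; first by exists 0; rewrite mulr0.
have [e] : divides c d by have := H 0%N; rewrite coefD coefMX coefC add0r.
move=> ->; have [|h ->] := IH.
  by move=> i; have := H i.+1; rewrite coefD coefMX coefC addr0.
by exists (h * 'X + e%:P); rewrite polyCM mulrDr mulrA.
Qed.

(** Gauss's lemma. Both polynomials are peeled from the constant term: [p]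
    divides the product of the constant terms, hence one of them, and that one
    can be removed from its polynomial. *)
Lemma prime_polyC p : prime_elt p -> prime_elt p%:P.
Proof.
case=> p0 pU pP; split.
- by rewrite polyC_eq0.
- by apply: contra pU; rewrite poly_unitE size_polyC p0 coefC /=.
move=> f; elim/poly_ind: f => [|f c IHf] g.
  by left; exists 0; rewrite mulr0.
elim/poly_ind: g => [|g d IHg]; first by right; exists 0; rewrite mulr0.
move=> H.
have /pP[] : divides p (c * d).
  case: H => h /(congr1 (fun q : {poly R} => q`_0)); rewrite coefCM.
  by rewrite coef0M !coefD !coefMX !coefC !add0r => ->; exists h`_0.
- case=> e ce.
  have pc : divides p%:P c%:P by exists e%:P; rewrite -polyCM ce.
  have /IHf[pf|] : divides p%:P (f * (g * 'X + d%:P)).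
    apply: divides_polyC_MX => //; rewrite mulrAC.
    apply: (@dividesDr _ _ (c%:P * (g * 'X + d%:P))); first exact: divides_mulr.
    by rewrite -mulrDl addrC.
  - left; case: pf => k ->; exists (k * 'X + e%:P).
    by rewrite mulrDr mulrA ce polyCM.
  - by right.
case=> e de.
have pd : divides p%:P d%:P by exists e%:P; rewrite -polyCM de.
have /IHg[|pg] : divides p%:P ((f * 'X + c%:P) * g).
  apply: divides_polyC_MX => //; rewrite -mulrA.
  apply: (@dividesDr _ _ ((f * 'X + c%:P) * d%:P)); first exact: divides_mull.
  by rewrite -mulrDr [d%:P + _]addrC.
- by left.
right; case: pg => k ->; exists (k * 'X + e%:P).
by rewrite mulrDr mulrA de polyCM.
Qed.

Lemma prime_polyC_inv p : prime_elt p%:P -> prime_elt p.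
Proof.
case; rewrite polyC_eq0 => p0 pU pP; split=> //.
  by apply: contra pU => U; apply: rmorph_unit.
have aux a : divides p%:P a%:P -> divides p a.
  case=> h /(congr1 (fun q : {poly R} => q`_0)); rewrite coefCM coefC /= => ->.
  by exists h`_0.
move=> a b [c E]; have /pP[] : divides p%:P (a%:P * b%:P).
- by exists c%:P; rewrite -!polyCM E.
- by move/aux; left.
- by move/aux; right.
Qed.

Lemma prime_product_polyC c : prime_product c -> prime_product c%:P.
Proof.
elim=> [u Uu|p a pp _ IH]; first by constructor; apply: rmorph_unit.
by rewrite polyCM; constructor => //; apply: prime_polyC.
Qed.

(** Turns divisibility over the field of fractions, which is all that
    pseudo-division gives, into divisibility over [R]. *)
Lemma divides_cancel_const c g f : prime_product c -> primitive g ->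
  divides g (c%:P * f) -> divides g f.
Proof.
move=> pc gP; elim: pc f => [u Uu|p a pp _ IH] f.
  case=> h E; exists (u^-1%:P * h).
  by rewrite mulrCA -E mulrA -polyCM mulVr // mul1r.
rewrite polyCM -mulrA => -[h E]; apply: IH.
have [p0 pU pP] := prime_polyC pp.
have [||[k hk]] := pP g h; first by rewrite -E; exists (a%:P * f).
- by move/gP; case: pp => _ /negP.
by exists k; apply: (mulfI p0); rewrite E hk mulrCA.
Qed.

(** Each prime factor of [c] divides [g] or [h] and is cancelled there, so that
    a factorization over the field of fractions becomes one over [R]. *)
Lemma factor_cancel_const c f g h : prime_product c -> c%:P * f = g * h ->
  exists g' h' b, [/\ b != 0, f = g' * h' & h = b%:P * h'].
Proof.
move=> pc; elim: pc f g h => [u Uu|p a pp _ IH] f g h.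
  move=> E; exists (u^-1%:P * g), h, 1.
  by rewrite oner_neq0 mul1r -mulrA -E mulrA -polyCM mulVr // mul1r.
rewrite polyCM -mulrA => E.
have [p0 pU pP] := prime_polyC pp.
have p0' : p != 0 by case: pp.
have [|[k Ek]|[k Ek]] := pP g h; first by rewrite -E; exists (a%:P * f).
- by apply: (IH f k h); apply: (mulfI p0); rewrite E Ek mulrA.
have /IH[g' [h' [b [b0 Ef Eh]]]] : a%:P * f = g * k.
  by apply: (mulfI p0); rewrite E Ek mulrCA.
exists g', h', (p * b); split=> //; first by rewrite mulf_neq0.
by rewrite Ek Eh polyCM mulrA.
Qed.

(** The content is built from the prime factors of the leading coefficient:
    they are removed from [f] one at a time, as often as they divide it. *)
Lemma content_primitive f : f != 0 -> factorial_ring R ->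
  exists c g, [/\ prime_product c, primitive g & f = c%:P * g].
Proof.
move=> f0 facR.
(* Invariant: [c] keeps every constant divisor of what is left of [f]. *)
suff key c : prime_product c ->
    forall g, (forall d, divides d%:P g -> divides d c) ->
    exists c' g', [/\ prime_product c', primitive g' & g = c'%:P * g'].
  have /key : prime_product (lead_coef f) by apply: facR; rewrite lead_coef_eq0.
  apply=> d [h ->]; exists (lead_coef h).
  by rewrite lead_coefM lead_coefC.
elim=> {c} [u Uu|p a pp _ IH] g H.
  exists 1, g; rewrite mul1r; split=> //; first by constructor; rewrite unitr1.
  by move=> d /H; apply: unit_of_dvd_unit.
have [p0 pU pP] := pp.
have [[h E]|npg] := classic (divides p%:P g).
  have [|c [g' [pc g'P Eh]]] := IH h.
    move=> d [k Ek]; have [|e Ee] := H (p * d).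
      by exists k; rewrite E Ek polyCM mulrA.
    by exists e; apply: (mulfI p0); rewrite Ee mulrA.
  exists (p * c), g'; split=> //; first by constructor.
  by rewrite E Eh polyCM mulrA.
apply: IH => d dg; have [e Ee] := H d dg.
have [|[k Ek]|[k Ek]] := pP d e; first by rewrite -Ee; exists a.
- by case: npg; case: dg => k' ->; rewrite Ek polyCM -mulrA; eexists.
by exists k; apply: (mulfI p0); rewrite Ee Ek mulrCA.
Qed.

(** If [f] divides [a * b], consider the pseudo-gcd of [f] and [a]. If it is
    constant, a Bezout relation puts a constant multiple of [b] in the ideal of
    [f]. Otherwise irreducibility makes it associated to [f] up to constants,
    so [f] divides a constant multiple of [a]. The constants cancel because [f]
    is primitive. *)
Lemma prime_of_primitive_irreducible f : factorial_ring R ->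
    primitive f -> (1 < size f)%N ->
    (forall g h, f = g * h -> (size g <= 1)%N \/ (size h <= 1)%N) ->
  prime_elt f.
Proof.
move=> facR fP f1 firr.
have f0 : f != 0 by rewrite -size_poly_gt0 ltnW.
split=> //; first by rewrite poly_unitE; case: (size f) f1 => [|[]].
move=> a b [w E]; have [|nfa] := classic (divides f a); [by left|right].
have [/Pdiv.Idomain.Bezout_coprimepP[[u v]]|] := boolP (coprimep f a).
  rewrite -size_poly_eq1 => /size_poly1P[c c0 /= Ec].
  apply: (divides_cancel_const (c := c)) => //; first exact: facR.
  exists (u * b + v * w); rewrite -Ec mulrDl -[v * a * b]mulrA E mulrDr.
  by rewrite [u * f * b]mulrAC [_ * f]mulrC [v * (f * w)]mulrCA.
rewrite coprimep_def => d1; case: nfa.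
set d := gcdp f a in d1.
have d0 : d != 0 by rewrite gcdp_eq0 negb_and f0.
have sd : (1 < size d)%N.
  by move: d0 d1; rewrite -size_poly_gt0; case: (size d) => [|[]].
have /Pdiv.Idomain.dvdpP[[c1 q1] /= c10 E1] := dvdp_gcdl f a.
have /Pdiv.Idomain.dvdpP[[c2 q2] /= c20 E2] := dvdp_gcdr f a.
have [|q [d' [c [c0 Ef Ed]]]] :=
    factor_cancel_const (f := f) (g := q1) (h := d) (facR _ c10).
  by rewrite mul_polyC E1.
have sd' : (1 < size d')%N by rewrite -(size_scale _ c0) -mul_polyC -Ed.
have qU : q \is a GRing.unit.
  have [] := firr _ _ Ef; last by rewrite leqNgt sd'.
  move/size1_polyC=> Eq; rewrite Eq; apply: rmorph_unit; apply: fP.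
  by exists d'; rewrite -Eq.
apply: (divides_cancel_const (c := c2)) => //; first exact: facR.
exists (q2 * c%:P * q^-1).
rewrite mul_polyC E2 -/d Ed Ef [RHS]mulrC !mulrA.
by rewrite mulrVK.
Qed.

(** Splitting off the content and splitting into factors of positive degree
    both stop, and a primitive polynomial that no longer splits is prime. *)
Theorem factorial_poly : factorial_ring R -> factorial_ring {poly R}.
Proof.
move=> facR f; have [n] := ubnP (size f); elim: n f => // n IH f szf f0.
have [c [g [pc gP E]]] := content_primitive f0 facR.
rewrite E; apply: prime_productM; first exact: prime_product_polyC.
have c0 := prime_product_neq0 pc.
have g0 : g != 0 by apply: contraNneq f0 => g0; rewrite E g0 mulr0.
have sg : size g = size f by rewrite E mul_polyC size_scale.
have [g1|g1] := leqP (size g) 1.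
  constructor; rewrite (size1_polyC g1); apply: rmorph_unit; apply: gP.
  by exists 1; rewrite -size1_polyC // mulr1.
have [[h [k [Eg h1 k1]]]|nex] := classic (exists h k,
    [/\ g = h * k, (1 < size h)%N & (1 < size k)%N]).
  have h0 : h != 0 by rewrite -size_poly_gt0 ltnW.
  have k0 : k != 0 by rewrite -size_poly_gt0 ltnW.
  move: szf; rewrite -sg Eg size_mul // ltnS => szf.
  have sh : (size h < n)%N.
    apply: leq_trans szf; case: (size k) k1 => [|[|m]] //= _.
    by rewrite !addnS ltnS leq_addr.
  have sk : (size k < n)%N.
    apply: leq_trans szf; case: (size h) h1 => [|[|m]] //= _.
    by rewrite !addSn ltnS leq_addl.
  by apply: prime_productM; apply: IH.
rewrite -[g]mulr1; apply: PrimeProductMul; last by constructor; rewrite unitr1.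
apply: prime_of_primitive_irreducible => // h k Eg.
have [|h1] := leqP (size h) 1; [by left|right].
by rewrite leqNgt; apply/negP => k1; case: nex; exists h, k.
Qed.
End Gauss.

(** * Factoriality of multivariate polynomials *)

Section LastVariable.
Context (n : nat) (R : idomainType).

(** Inverse of [muni], given as a composite of ring morphisms so that it is one
    without further proof. *)
Definition of_muni : {poly {mpoly R[n]}} -> {mpoly R[n.+1]} :=
  horner_eval 'X_ord_max \o map_poly (@mwiden n R).

HB.instance Definition _ := GRing.RMorphism.copy of_muni
  (horner_eval 'X_ord_max \o map_poly (@mwiden n R)).

Lemma muni_mwiden (q : {mpoly R[n]}) : muni (mwiden q) = q%:P.
Proof.
rewrite [q]mpolyE (raddf_sum (@mwiden n R)) (raddf_sum (@muni n R)).
rewrite (raddf_sum (@polyC _)).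
apply: eq_bigr => m _ /=.
rewrite mwidenZ muniZ -[RHS]/((_ *: _)%:P) -mul_mpolyC polyCM mul_polyC mwidenX.
congr (_ *: _); rewrite muniE msuppX big_seq1 mcoeffX eqxx scale1r.
rewrite mnmwiden_ordmax expr0 alg_polyC; congr ('X_[_])%:P.
by apply/mnmP=> i; rewrite mnmE mnmwiden_widen.
Qed.

Lemma of_muniX : of_muni 'X = 'X_ord_max.
Proof. by rewrite /of_muni /= map_polyX /horner_eval hornerX. Qed.

Lemma of_muniC c : of_muni c%:P = mwiden c.
Proof. by rewrite /of_muni /= map_polyC /horner_eval hornerC. Qed.

Lemma of_muniK : cancel of_muni (@muni n R).
Proof.
elim/poly_ind => [|p c IH]; first by rewrite !rmorph0.
rewrite (rmorphD of_muni) (rmorphM of_muni) muniD muniM IH.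
rewrite /= of_muniX of_muniC muni_mwiden; congr (_ * _ + _).
rewrite muniE msuppX big_seq1 mcoeffX eqxx scale1r mnm1E eqxx expr1.
rewrite (_ : [multinom _ | i < n] = 0%MM) ?mpolyX0 ?scale1r //.
apply/mnmP=> i; rewrite mnmE mnm0E mnm1E -val_eqE /= gtn_eqF //.
Qed.

Lemma muniK : cancel (@muni n R) of_muni.
Proof.
move=> p; rewrite muniE (raddf_sum of_muni) [RHS]mpolyE.
apply: eq_bigr => m _ /=.
rewrite -mul_polyC (rmorphM of_muni) (rmorphXn of_muni) /= of_muniX of_muniC.
rewrite mwidenZ mwidenX -scalerAl; congr (_ *: _).
rewrite mpolyXn -mpolyXD; congr 'X_[_]; apply/mnmP=> i.
rewrite mnmDE mulmnE mnm1E; case: (unliftP ord_max i) => [j|] ->.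
  have -> : lift ord_max j = widen_ord (leqnSn n) j.
    by apply: ord_inj; rewrite lift_max.
  by rewrite mnmwiden_widen mnmE -val_eqE /= gtn_eqF // mul0n addn0.
by rewrite mnmwiden_ordmax eqxx mul1n.
Qed.

Definition extend_point (t : 'I_n -> R) (x : R) (i : 'I_n.+1) : R :=
  if unlift ord_max i is Some j then t j else x.

Lemma meval_muni (p : {mpoly R[n.+1]}) t x :
  p.@[extend_point t x] = (map_poly (meval t) (muni p)).[x].
Proof.
rewrite muniE raddf_sum horner_sum mevalE; apply: eq_bigr => m _ /=.
rewrite map_polyZ map_polyXn hornerZ hornerXn /= mevalZ mevalX -mulrA.
congr (_ * _); rewrite big_ord_recr /= {2}/extend_point unlift_none.
congr (_ * _); apply: eq_bigr => i _; rewrite mnmE; congr (_ ^+ _).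
have -> : widen_ord (leqnSn n) i = lift ord_max i.
  by apply: ord_inj; rewrite lift_max.
by rewrite /extend_point liftK.
Qed.
End LastVariable.

Lemma mpoly0_const (R : idomainType) (p : {mpoly R[0]}) : p = (p@_0)%:MP.
Proof.
apply/mpolyP=> m; rewrite mcoeffC (_ : m = 0%MM) ?eqxx ?mulr1 //.
by apply/mnmP; case.
Qed.

Lemma mpoly_unit_const n (R : idomainType) (p : {mpoly R[n]}) :
  p \is a GRing.unit -> exists2 c, c != 0 & p = c%:MP.
Proof.
case/andP=> /eqP Ep Up; exists p@_0 => //.
by apply: contraTneq Up => ->; rewrite unitr0.
Qed.

(** Gauss's theorem, one variable at a time. *)
Theorem factorial_mpoly (K : fieldType) n : factorial_ring {mpoly K[n]}.
Proof.
elim: n => [|n IH] p p0.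
  constructor; rewrite (mpoly0_const p); apply: rmorph_unit; rewrite unitfE.
  by apply: contraNneq p0 => E; rewrite (mpoly0_const p) E rmorph0.
rewrite -(muniK p).
apply: (prime_product_iso (@of_muniK n K) (@muniK n K)).
apply: (factorial_poly IH).
by rewrite -(rmorph0 (@muni n K)) (inj_eq (can_inj (@muniK n K))).
Qed.

(** * Zeros of polynomials over an algebraically closed field *)

Lemma mpoly_nonroot (K : closedFieldType) n (p : {mpoly K[n]}) :
  p != 0 -> exists t, p.@[t] != 0.
Proof.
elim: n p => [|n IH] p p0.
  exists (fun=> 0); rewrite (mpoly0_const p) mevalC.
  by apply: contraNneq p0 => E; rewrite (mpoly0_const p) E rmorph0.
have q0 : muni p != 0.
  by rewrite -(rmorph0 (@muni n K)) (inj_eq (can_inj (@muniK n K))).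
have /IH[t lt0] : lead_coef (muni p) != 0 by rewrite lead_coef_eq0.
have /closed_nonrootP[x px] : map_poly (meval t) (muni p) != 0.
  apply: contraNneq lt0 => E.
  by rewrite lead_coefE -(coef_map (meval t)) /= E coef0.
by exists (extend_point t x); rewrite meval_muni.
Qed.

(** A prime of positive degree divides no non-zero constant. Were the pseudo-gcd
    not constant, [f] would divide it, hence a constant multiple of [g]. *)
Lemma coprimep_prime (R : idomainType) (f g : {poly R}) :
  prime_elt f -> (1 < size f)%N -> ~ divides f g -> coprimep f g.
Proof.
move=> [f0 fU fP] f1 ndiv; rewrite coprimep_def.
have nconst c : c != 0 -> ~ divides f c%:P.
  move=> c0 [h] /(congr1 (fun q : {poly R} => size q)).
  rewrite size_polyC c0; have [->|h0] := eqVneq h 0.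
    by rewrite mulr0 size_poly0.
  rewrite size_mul //; move: f1 h0; rewrite -size_poly_gt0.
  by case: (size f) => [|[|k]] //; case: (size h) => // l; rewrite !addSn addnS.
set d := gcdp f g.
have d0 : d != 0 by rewrite gcdp_eq0 negb_and f0.
have /Pdiv.Idomain.dvdpP[[c1 q1] /= c10 E1] := dvdp_gcdl f g.
have /Pdiv.Idomain.dvdpP[[c2 q2] /= c20 E2] := dvdp_gcdr f g.
rewrite -/d in E1 E2.
have q10 : q1 != 0.
  apply/eqP => q0; move: E1; rewrite q0 mul0r -mul_polyC; apply/eqP.
  by rewrite mulf_neq0 // polyC_eq0.
have [|[k Ek]|[k Ek]] := fP q1 d.
- by rewrite -E1 -mul_polyC; exists c1%:P; rewrite mulrC.
- have Ec : c1%:P = k * d.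
    by apply: (mulfI f0); rewrite mulrC mul_polyC E1 Ek mulrA.
  have := congr1 (fun q : {poly R} => size q) Ec.
  have k0 : k != 0 by apply: contraNneq q10 => k0; rewrite Ek k0 mulr0.
  rewrite size_polyC c10 size_mul //; move: k0 d0; rewrite -!size_poly_gt0.
  case: (size k) => // a _; case: (size d) => // b _.
  by rewrite addSn addnS /= => -[]; case: b => // b; rewrite addnS.
have [] := fP c2%:P g; last 2 first.
- by move/(nconst _ c20).
- by move/ndiv.
by exists (k * q2); rewrite mul_polyC E2 Ek mulrCA [q2 * k]mulrC.
Qed.

(** This replaces the Nullstellensatz. If [f] has positive degree in the last
    variable, a Bezout relation [u f + v g = c] with [c <> 0] free of that
    variable shows that [g] cannot vanish at a zero of [f] lying over a point
    where [c] does not vanish; keeping also the leading coefficient of [f]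
    non-zero ensures that such a zero exists. Otherwise [f] does not involve the
    last variable, and the induction hypothesis applies to [f] and a
    coefficient of [g]. *)
Lemma hypersurface_zero_avoiding (K : closedFieldType) n (f g : {mpoly K[n]}) :
  prime_elt f -> ~ divides f g -> exists t, f.@[t] = 0 /\ g.@[t] != 0.
Proof.
elim: n f g => [|n IH] f g fpr ndiv.
  case: fpr => f0 /negP[]; rewrite (mpoly0_const f); apply: rmorph_unit.
  rewrite unitfE.
  by apply: contraNneq f0 => E; rewrite (mpoly0_const f) E rmorph0.
have {}ndiv : ~ divides (muni f) (muni g).
  by move/(divides_iso (@muniK n K) (@of_muniK n K)).
have {fpr} fpr : prime_elt (muni f).
  exact: (prime_iso (@muniK n K) (@of_muniK n K) fpr).
suff [t [x [ft gt]]] : exists t x, (map_poly (meval t) (muni f)).[x] = 0 /\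
    (map_poly (meval t) (muni g)).[x] != 0.
  by exists (extend_point t x); rewrite !meval_muni.
move: {f} (muni f) {g} (muni g) fpr ndiv => f g fpr ndiv.
have [f1|f1] := leqP (size f) 1.
  move: fpr ndiv; rewrite (size1_polyC f1); move: f`_0 => c cpr ndiv.
  have [i ci] : exists i, ~ divides c g`_i.
    by apply: not_all_ex_not => H; apply: ndiv; apply: divides_polyC_coef.
  have [t [ct gt]] := IH _ _ (prime_polyC_inv cpr) ci.
  have /closed_nonrootP[x gx] : map_poly (meval t) g != 0.
    by apply: contraNneq gt => E; rewrite -(coef_map (meval t)) /= E coef0.
  by exists t, x; rewrite map_polyC hornerC /= ct.
have := coprimep_prime fpr f1 ndiv.
move=> /Pdiv.Idomain.Bezout_coprimepP[[u v]].
rewrite -size_poly_eq1 => /size_poly1P[c c0 /= Ec].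
have f0 : f != 0 by case: fpr.
have /mpoly_nonroot[t] : c * lead_coef f != 0.
  by rewrite mulf_neq0 ?lead_coef_eq0.
rewrite mevalM mulf_eq0 negb_or => /andP[ct lt].
have /closed_rootP[x fx] : size (map_poly (meval t) f) != 1%N.
  by rewrite size_map_poly_id0 // gtn_eqF.
exists t, x; split; first exact/eqP.
apply: contraNneq ct => gx.
have /(congr1 (fun q => (map_poly (meval t) q).[x])) := Ec.
rewrite !rmorphD !rmorphM !hornerD !hornerM gx (eqP fx) !mulr0 addr0.
by rewrite map_polyC hornerC /= => <-.
Qed.

(** * Coprime families *)

Lemma coprime_family_of_prime (K : fieldType) n m (p : m.-tuple {mpoly K[n]}) :
  (exists i, tnth p i != 0) ->
  (forall f, prime_elt f -> ~ (forall i, divides f (tnth p i))) ->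
  coprime_family p.
Proof.
move=> [i pi0] H g gdiv.
have : g != 0.
  by apply: contraNneq pi0 => g0; have [h ->] := gdiv i; rewrite g0 mul0r.
move/factorial_mpoly=> gpp; case: gpp gdiv => [//|f a fpr _] gdiv.
case: (H f fpr) => j; have [h ->] := gdiv j.
by exists (a * h); rewrite mulrA.
Qed.

(** Each prime factor of [p_j] divides [p_i r_j] for every [i], hence divides
    [r_j] because the [p_i] are coprime. So [p_j] divides [r_j], the quotient
    divides every [r_i], and it is a unit because the [r_i] are coprime. *)
Lemma proportional_coprime (K : fieldType) n m (p r : m.-tuple {mpoly K[n]}) :
    coprime_family p -> coprime_family r ->
    (forall i j, tnth p i * tnth r j = tnth p j * tnth r i) ->
    (exists i, tnth p i != 0) ->
  exists2 c : K, c != 0 & forall i, tnth r i = c *: tnth p i.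
Proof.
move=> pcop rcop E [j pj0].
(* [a] and [b] stand for what is left of [p_j] and [r_j] after cancelling. *)
suff key a : prime_product a -> forall b,
    (forall i, a * tnth r i = tnth p i * b) -> exists c, b = a * c.
  have [|c Ec] := key _ (factorial_mpoly pj0) (tnth r j).
    by move=> i; rewrite E.
  have rE i : tnth r i = c * tnth p i.
    by apply: (mulfI pj0); rewrite -E Ec mulrCA [_ * c]mulrC.
  have /mpoly_unit_const[c0 c00 Ec0] : c \is a GRing.unit.
    by apply: rcop => i; exists (tnth p i).
  by exists c0 => // i; rewrite rE Ec0 mul_mpolyC.
elim=> {a} [u Uu|f a fpr _ IH] b H.
  by exists (u^-1 * b); rewrite mulrA mulrV // mul1r.
have [f0 /negP fU fP] := fpr.
have [k Ek] : divides f b.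
  apply: NNPP => nb; apply: fU; apply: pcop => i.
  have [|[h ->]|//] := fP (tnth p i) b; last by exists h.
  by rewrite -H -mulrA; exists (a * tnth r i).
have [|c Ec] := IH k; last by exists c; rewrite Ek Ec mulrA.
by move=> i; apply: (mulfI f0); rewrite mulrA H Ek mulrCA.
Qed.

(** * Evaluation and homogeneity *)

Lemma rmorph_mmap n (R : nzRingType) (T U : comNzRingType)
    (h : {rmorphism T -> U}) (f : R -> T) (w : 'I_n -> T) (p : {mpoly R[n]}) :
  h (mmap f w p) = mmap (h \o f) (h \o w) p.
Proof.
rewrite rmorph_sum; apply: eq_bigr => m _; rewrite rmorphM; congr (_ * _).
by rewrite rmorph_prod; apply: eq_bigr => i _; rewrite rmorphXn.
Qed.

Lemma mmap_dhomogZ n (R : nzRingType) (T : comNzRingType) (f : R -> T)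
    (c : T) (w : 'I_n -> T) (p : {mpoly R[n]}) d : p \is d.-homog ->
  mmap f (fun i => c * w i) p = c ^+ d * mmap f w p.
Proof.
move=> /dhomogP pd; rewrite /mmap mulr_sumr; apply: eq_big_seq => m /pd <-.
rewrite mulrCA; congr (_ * _).
rewrite /= /mmap1 mdegE -prodrXr -big_split /=.
by apply: eq_bigr => i _; rewrite exprMn.
Qed.

Lemma meval_dhomogZ n (R : comNzRingType) c (t : 'I_n -> R)
    (p : {mpoly R[n]}) d :
  p \is d.-homog -> p.@[fun i => c * t i] = c ^+ d * p.@[t].
Proof. exact: mmap_dhomogZ. Qed.

(** * Composition with a map without base points *)

Definition base_free (K : fieldType) n m (Q : ratmap K n m) : Prop :=
  forall a, ~~ base_locus Q a.

Lemma base_free_value (K : fieldType) n m (Q : ratmap K n m) a :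
  base_free Q -> is_point a -> exists i, (tnth Q i).@[a] != 0.
Proof.
by move=> Qb pa; have := Qb a; rewrite negb_and pa /= negb_forall => /existsP.
Qed.

(** A common prime factor would have a zero [t] where [S] is defined, and [S(t)]
    would be a base point of [Q]. *)
Lemma coprime_base_free_comp (K : closedFieldType) n l m
    (Q : ratmap K l m) (S : ratmap K n l) : base_free Q ->
    (exists i, tnth Q i \mPo S != 0) ->
  coprime_family [tuple tnth Q i \mPo S | i < m].
Proof.
move=> Qb [i0 Qi0]; apply: coprime_family_of_prime.
  by exists i0; rewrite tnth_mktuple.
move=> f fpr fdiv; have [k Sk] : exists k, ~ divides f (tnth S k).
  apply: not_all_ex_not => H; case: fpr => _ /negP fU _; apply: fU.
  exact: (comps_coprime (r := S) H).
have [t [ft St]] := hypersurface_zero_avoiding fpr Sk.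
have [|i] := @base_free_value _ _ _ Q (evmap S t) Qb.
  by apply/existsP; exists k.
rewrite -comp_mpoly_meval; have := fdiv i; rewrite tnth_mktuple => -[h ->].
by rewrite mevalM ft mul0r eqxx.
Qed.

Lemma dhomog_comp (K : fieldType) n l (q : {mpoly K[l]})
    (s : l.-tuple {mpoly K[n]}) e d : q \is e.-homog -> (forall i, tnth s i \is d.-homog) ->
  q \mPo s \is (e * d).-homog.
Proof.
move=> /dhomogP qe sd; rewrite comp_mpolyEX big_seq.
apply: rpred_sum => m /qe <-; apply: rpredZ; rewrite comp_mpolyX /= mdegE.
rewrite big_distrl /=.
elim/big_rec2: _ => [|i x y _]; first exact: dhomog1.
by move=> yd; apply: dhomogM => //; rewrite mulnC; apply: dhomogMn.
Qed.

Lemma base_free_comp_lowest_terms (K : closedFieldType) n l m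
    (P : ratmap K n m) (Q : ratmap K l m) (S : ratmap K n l) i :
    base_free Q -> Defs.eq_comp P Q S -> tnth P i != 0 ->
  (exists2 c : K, c != 0 & forall j, tnth Q j \mPo S = c *: tnth P j) /\
  rdeg P = (rdeg Q * rdeg S)%N.
Proof.
move=> Qb [QS0 E] Pi0.
have [||c c0 cE] := @proportional_coprime _ _ _ P
    [tuple tnth Q i \mPo S | i < m] (@comps_coprime _ _ _ P)
    (coprime_base_free_comp Qb QS0).
- by move=> j k; rewrite !tnth_mktuple.
- by exists i.
have {}cE j : tnth Q j \mPo S = c *: tnth P j by rewrite -cE tnth_mktuple.
split; first by exists c.
apply: (dhomog_uniq (mf := mdeg) (p := c *: tnth P i)).
- by rewrite -mul_mpolyC mulf_neq0 // mpolyC_eq0.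
- exact/dhomogZ/comps_homog.
by rewrite -cE; apply: dhomog_comp => [|k]; apply: comps_homog.
Qed.

(** * Restriction to lines *)

Lemma pihomog_mdeg_neq0 n (R : nzRingType) (p : {mpoly R[n]}) m :
  p@_m != 0 -> pihomog mdeg (mdeg m) p != 0.
Proof.
apply: contraNneq => E.
rewrite (pihomog_partitionE (mf := mdeg) (leqnn (msize p))).
rewrite raddf_sum big1 // => d _ /=.
have [->|ne] := eqVneq (d : nat) (mdeg m); first by rewrite E mcoeff0.
by rewrite (dhomog_nemf_coeff (pihomogP _ _ _)) // eq_sym.
Qed.

Section Line.
Context (K : fieldType) (n : nat).

(** Restriction to the line through the origin with direction [u]. The factor
    ['X] comes first so that homogeneity of degree [d] takes out ['X^d]. *)
Definition on_line (u : 'I_n -> K) : {mpoly K[n]} -> {poly K} :=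
  mmap polyC (fun j => 'X * (u j)%:P).

HB.instance Definition _ u := GRing.RMorphism.copy (on_line u)
  (mmap polyC (fun j => 'X * (u j)%:P)).

(** Splitting [p] into its homogeneous parts sorts the restriction by powers
    of ['X]. *)
Lemma coef_on_line u p k : (on_line u p)`_k = (pihomog mdeg k p).@[u].
Proof.
have le : (msize p <= maxn (msize p) k.+1)%N by rewrite leq_maxl.
rewrite {1}(pihomog_partitionE (mf := mdeg) le) rmorph_sum coef_sum /=.
have lt : (k < maxn (msize p) k.+1)%N by rewrite leq_maxr.
have E (d : nat) : on_line u (pihomog mdeg d p) =
    'X^d * ((pihomog mdeg d p).@[u])%:P.
  rewrite /on_line (mmap_dhomogZ _ _ _ (pihomogP mdeg d p)).
  by rewrite (rmorph_mmap (@polyC K)).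
rewrite (bigD1 (Ordinal lt)) //= E coefXnM ltnn subnn coefC eqxx.
rewrite big1 ?addr0 // => d; rewrite -val_eqE /= E coefXnM coefC.
by case: ltngtP => //; rewrite subn_eq0 => dk; rewrite leqNgt dk.
Qed.

(** A coefficient on the line bounds the multiplicity from above. *)
Lemma on_line_monomial u p k : (on_line u p)`_k != 0 ->
  exists2 m, mdeg m = k & p@_m != 0.
Proof.
rewrite coef_on_line => nz; apply: NNPP => H; case/eqP: nz.
rewrite pihomogE big_seq_cond big_pred0 ?meval0 // => m.
apply/andP => -[mp /eqP mk]; apply: H; exists m => //.
by rewrite -mcoeff_msupp.
Qed.
End Line.

(** [v] is the least order at 0 among the [w k], hence at most that of [w i]. *)
Lemma factor_polyX (K : fieldType) (I : finType) (w : I -> {poly K}) i r :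
    (w i)`_r != 0 ->
  exists v w', [/\ (v <= r)%N, forall k, w k = 'X^v * w' k
    & exists k, (w' k).[0] != 0].
Proof.
elim: r w => [|r IH] w wr;
  have [[k wk]|H] := classic (exists k, (w k).[0] != 0).
- by exists 0%N, w; split=> //; [move=> j; rewrite mul1r | exists k].
- by case: H; exists i; rewrite horner_coef0.
- by exists 0%N, w; split=> //; [move=> j; rewrite mul1r | exists k].
have wE k : w k = 'X * drop_poly 1 (w k).
  rewrite -{1}(poly_take_drop 1 (w k)) mulrC.
  rewrite [take_poly 1 _](_ : _ = 0) ?add0r //.
  apply/polyP=> j; rewrite coef_take_poly coef0; case: j => //=.
  rewrite -horner_coef0; apply/eqP; apply: contra_notT H => wk; by exists k.
have [|v [w' [vr w'E w'0]]] := IH (fun k => drop_poly 1 (w k)).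
  by rewrite coef_drop_poly addn1.
exists v.+1, w'; split=> // k.
by rewrite wE w'E mulrA -exprS.
Qed.

(** * Local equations and multiplicities *)

HB.instance Definition _ (K : fieldType) (a : 'I_3 -> K) :=
  GRing.RMorphism.copy (local_eq a) (@comp_mpoly 3 K 2 _).

Lemma local_eqZ (K : fieldType) (a : 'I_3 -> K) c f :
  local_eq a (c *: f) = c *: local_eq a f.
Proof. exact: comp_mpolyZ. Qed.

Lemma local_eq_meval (K : fieldType) (a : 'I_3 -> K) f u :
  (local_eq a f).@[u] = f.@[fun k => a k +
    (if unlift (odflt ord0 [pick i | a i != 0]) k is Some j then u j else 0)].
Proof.
rewrite comp_mpoly_meval; apply: meval_eq => k.
rewrite tnth_mktuple mevalD mevalC.
by case: unlift => [j|]; rewrite ?mevalXU ?meval0.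
Qed.

(** Dehomogenization loses nothing: a point [t] off the hyperplane [X_i = 0]
    where [f(t) <> 0] can be rescaled into the chart of [a]. *)
Lemma local_eq_neq0 (K : closedFieldType) (a : 'I_3 -> K) f d :
  is_point a -> f \is d.-homog -> f != 0 -> local_eq a f != 0.
Proof.
move=> /existsP pa fd f0.
have [i Ei ai] : exists2 i, odflt ord0 [pick i | a i != 0] = i & a i != 0.
  by case: pickP => [i ai|H]; [exists i | case: pa => i; rewrite H].
have /mpoly_nonroot[t] : 'X_i * f != 0.
  by rewrite mulf_neq0 // -msize_poly_eq0 msizeX.
rewrite mevalM mevalXU mulf_eq0 negb_or => /andP[ti ft].
have ta0 : a i / t i != 0 by rewrite mulf_neq0 ?invr_eq0.
apply: contraNneq ft => L0.
have := meval0 (fun j : 'I_2 => a i / t i * t (lift i j) - a (lift i j)).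
rewrite -{}L0 local_eq_meval Ei => E.
apply/eqP; apply: (mulfI (expf_neq0 d ta0)).
rewrite mulr0 -(meval_dhomogZ _ _ fd) -[RHS]E.
apply: meval_eq => k; case: (unliftP i k) => [j|] -> /=.
  by rewrite addrC subrK.
by rewrite addr0 mulfVK.
Qed.

Lemma curve_mult_le (K : fieldType) (a : 'I_3 -> K) f m :
  (local_eq a f)@_m != 0 -> (curve_mult a f <= mdeg m)%N.
Proof. by move=> fm; apply/lemc_mdeg/mlast_lemc; rewrite mcoeff_msupp. Qed.

Lemma local_eq_map (K F : fieldType) (h : {rmorphism K -> F}) a f :
  local_eq (h \o a) (map_mpoly h f) = map_mpoly h (local_eq a f).
Proof.
rewrite /local_eq map_mpoly_comp; last exact: fmorph_inj.
have -> : [pick i | (h \o a) i != 0] = [pick i | a i != 0].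
  by apply: eq_pick => i /=; rewrite fmorph_eq0.
congr (_ \mPo _); apply: eq_from_tnth => k; rewrite tnth_map !tnth_mktuple.
rewrite rmorphD /= map_mpolyC; congr (_ + _).
by case: unlift => [j|]; rewrite ?rmorph0 // map_mpolyX.
Qed.

HB.instance Definition _ (K : fieldType) m (F : fieldType)
    (iota : {rmorphism genfrac K m -> F}) :=
  GRing.RMorphism.copy (gen_const iota) (iota \o @tofrac _ \o @mpolyC _ _).

(** The indeterminates [x_i] are linearly independent over [K], so a monomial
    of the local equation of one component cannot cancel in [W1]. *)
Lemma curve_mult_W1_le (K F : fieldType) m (iota : {rmorphism genfrac K m -> F})
    (M : ratmap K 3 m) (a : 'I_3 -> K) j mu :
  (local_eq a (tnth M j))@_mu != 0 ->
  (curve_mult (gen_const iota \o a) (W1 iota M) <= mdeg mu)%N.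
Proof.
move=> nz; apply: curve_mult_le.
rewrite /W1 (raddf_sum (local_eq _)) raddf_sum /=.
(* The coefficient of [W1] at [mu] is the image of a non-zero linear form in
   the [x_i], with coefficients in [K]. *)
pose c i := (local_eq a (tnth M i))@_mu.
have -> : \sum_(i < m) (local_eq (gen_const iota \o a)
      (iota (tofrac 'X_(lshift m i)) *: map_mpoly (gen_const iota) (tnth M i)))@_mu
    = iota (tofrac (\sum_(i < m) c i *: 'X_(lshift m i))).
  rewrite !rmorph_sum; apply: eq_bigr => i _ /=.
  rewrite local_eqZ local_eq_map mcoeffZ.
  by rewrite mcoeff_map_mpoly -mul_mpolyC !rmorphM mulrC.
rewrite fmorph_eq0 tofrac_eq0.
apply: contraNneq nz => /(congr1 (mcoeff U_(lshift m j)%MM)).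
rewrite mcoeff0 raddf_sum (bigD1 j) //= mcoeffZ mcoeffX eqxx mulr1.
rewrite big1 ?addr0; first by move/eqP.
move=> i ij; rewrite mcoeffZ mcoeffX; case: eqP => [|_]; last by rewrite mulr0.
move=> /mnmP/(_ (lshift m j)); rewrite !mnm1E eqxx (inj_eq (@lshift_inj _ _)).
by rewrite (negPf ij).
Qed.

(** * Multiplicities of the reparametrization *)

(** In fact equality holds for the smallest multiplicity among the [s_k] and
    the smallest one among the [q_j(S)]. For an upper bound by the multiplicity
    of one given [s_i], a line that is generic for this [s_i] is enough. *)
Lemma local_mult_base_free_comp (K : closedFieldType) l m
    (Q : ratmap K l m) (S : ratmap K 3 l) (a : 'I_3 -> K) i :
    base_free Q -> is_point a -> tnth S i != 0 ->
  exists j mu, (mdeg mu <= rdeg Q * curve_mult a (tnth S i))%N /\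
    (local_eq a (tnth Q j \mPo S))@_mu != 0.
Proof.
move=> Qb pa Si0; set r := curve_mult a (tnth S i).
have Li0 := local_eq_neq0 pa (comps_homog S i) Si0.
have /mpoly_nonroot[u] : pihomog mdeg r (local_eq a (tnth S i)) != 0.
  by apply: pihomog_mdeg_neq0; rewrite -mcoeff_msupp mlast_supp.
(* [u] is not tangent to any branch of the curve [s_i] at [a]. *)
rewrite -coef_on_line => ur.
pose w k := on_line u (local_eq a (tnth S k)).
have [v [w' [vr wE [k0 wk0]]]] := @factor_polyX _ _ w i r ur.
have [|j qj] := @base_free_value _ _ _ Q (fun k => (w' k).[0]) Qb.
  by apply/existsP; exists k0.
have qE : on_line u (local_eq a (tnth Q j \mPo S)) =
    'X^(v * rdeg Q) * mmap polyC w' (tnth Q j).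
  rewrite exprM -(mmap_dhomogZ _ _ _ (comps_homog Q j)).
  rewrite [LHS](rmorph_mmap (on_line u \o local_eq a)).
  rewrite /mmap; apply: eq_bigr => mu _; congr (_ * _).
    by rewrite /= /local_eq comp_mpolyC [LHS]mmapC.
  by apply: mmap1_eq => k /=; rewrite -wE.
have [|mu Emu mu0] :=
    @on_line_monomial _ _ u (local_eq a (tnth Q j \mPo S)) (v * rdeg Q).
  rewrite qE coefXnM ltnn subnn -horner_coef0.
  rewrite -[_.[0]]/(horner_eval 0 _) rmorph_mmap.
  rewrite (_ : mmap _ _ _ = (tnth Q j).@[fun k => (w' k).[0]]) //.
  by apply: eq_bigr => mu _; rewrite /= /horner_eval hornerC.
by exists j, mu; rewrite Emu mulnC leq_mul2l vr orbT.
Qed.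

(** Forms of degree 0 are constant. *)
Lemma base_free_rdeg0 (K : closedFieldType) n m (M : ratmap K n m) i :
  tnth M i != 0 -> rdeg M = 0%N -> base_free M.
Proof.
move=> Mi0 M0 a; apply/negP => /andP[_ /forallP/(_ i)/eqP Ma].
have [t /eqP[]] := mpoly_nonroot Mi0.
have := comps_homog M i; rewrite M0 => h.
have E s : (tnth M i).@[s] = (tnth M i).@[fun=> 0].
  rewrite -[LHS]mul1r -[X in X * _](expr0 (0 : K)) -(meval_dhomogZ _ _ h).
  by apply: meval_eq => k; rewrite mul0r.
by rewrite E -Ma E.
Qed.

Theorem theorem3 (K : closedFieldType) (charK0 : [pchar K] =i pred0)
    (* F is an algebraic closure of K(x, y) *)
    (F : closedFieldType) (iota : {rmorphism genfrac K 4 -> F})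
    (F_alg : forall z : F, algebraicOver iota z)
    (X : surface K)
    (P : ratmap K 3 4) (P_param : parametrizes P X)
    (P4_neq0 : tnth P ord_max != 0)
    (P_nonbirational : ~ birational_onto P X)
    (P_transversal : transversal_map iota P)
    (Q : ratmap K 3 4) (Q_birational : birational_parametrization Q X)
    (Q_base : forall a : 'I_3 -> K, ~~ base_locus Q a)
    (S : ratmap K 3 3) (QS_solves : solves_birational_reparam X P Q S)
    (d : nat) (d_def : d%:R = (rdeg P)%:R / sqrtC (sdeg X)%:R :> algC)
    (S_deg : rdeg S = d) :
  forall i : 'I_3, in_linear_system d (base_divisor iota P (sdeg X)) (tnth S i).
Proof.
move=> i; split; first by rewrite -S_deg comps_homog.
move=> Si0 a pa; rewrite /base_divisor.
case: ifP => [aP|_]; last by rewrite ler0n.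
have [[c c0 QS] PE] :=
  base_free_comp_lowest_terms Q_base QS_solves.2 P4_neq0.
have [j [mu [mule muQS]]] := local_mult_base_free_comp Q_base pa Si0.
have mle : (curve_mult (gen_const iota \o a) (W1 iota P) <=
            rdeg Q * curve_mult a (tnth S i))%N.
  apply: leq_trans mule; apply: (@curve_mult_W1_le _ _ _ iota P a j).
  by move: muQS; rewrite QS local_eqZ mcoeffZ mulf_eq0 negb_or => /andP[].
rewrite (P_transversal _ aP).
(* Otherwise [P] would be constant, and would have no base point. *)
have d0 : d != 0%N.
  apply: contraL aP => /eqP d0; apply: (base_free_rdeg0 P4_neq0).
  by rewrite PE S_deg d0 muln0.
have dC0 : d%:R != 0 :> algC by rewrite pnatr_eq0.
have degX0 : sqrtC (sdeg X)%:R != 0 :> algC.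
  by apply: contraNneq dC0 => E; rewrite d_def E invr0 mulr0.
(* Compare [d * sqrt (deg X) = deg P] with [deg P = deg Q * d]. *)
have degX : sqrtC (sdeg X)%:R = (rdeg Q)%:R :> algC.
  by apply: (mulIf dC0); rewrite {1}d_def mulrC divfK // PE S_deg natrM.
rewrite degX in degX0.
rewrite natrX -[(sdeg X)%:R]sqrtCK degX -expr_div_n.
rewrite sqrCK ?divr_ge0 ?ler0n // ler_pdivrMr ?lt0r ?degX0 ?ler0n //.
by rewrite -natrM ler_nat mulnC.
Qed.
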